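(* Let $n\ge 1$ and let $p_1,\ldots,p_n:[0,1]\to[0,1]$ be affine functions with $p_i'\ge 0$ for all $i$. For $t\in[0,1]$ let $(f_k(t))_{k=0,\ldots,n}$ be the probability mass function of $B_1+\cdots+B_n$, where $B_1,\ldots,B_n$ are independent Bernoulli random variables with parameters $p_1(t),\ldots,p_n(t)$. Then the entropy $$H(t) := -\sum_{k=0}^n f_k(t)\log f_k(t)$$ (with the convention $0\log 0=0$) is a concave function of $t\in[0,1]$.
   Context: An affine function $p_i:[0,1]\to[0,1]$ has the form $p_i(t)=(1-t)p_i(0)+t\,p_i(1)$; $p_i'$ denotes its (constant) derivative. *)

(* Defs.v *)
From Stdlib Require Import Reals.
Open Scope R_scope.

Definition affine (a b t : R) : R := (1 - t) * a + t * b.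

(* pmf q m k = P(B_0 + ... + B_{m-1} = k), where the B_i are independent
   Bernoulli(q i).  Defined by conditioning on the last variable B_{m-1}
   (the sum over all outcomes, factored). *)
Fixpoint pmf (q : nat -> R) (m k : nat) : R :=
  match m with
  | O => match k with O => 1 | S _ => 0 end
  | S m' => (1 - q m') * pmf q m' k
            + q m' * match k with O => 0 | S k' => pmf q m' k' end
  end.

Definition xlogx (x : R) : R := if Rle_dec x 0 then 0 else x * ln x.

Definition entropy (f : nat -> R) (n : nat) : R :=
  - sum_f_R0 (fun k => xlogx (f k)) n.

Definition concave_on_01 (H : R -> R) : Prop :=
  forall x y l, 0 <= x <= 1 -> 0 <= y <= 1 -> 0 <= l <= 1 ->
    l * H x + (1 - l) * H y <= H (l * x + (1 - l) * y).

(* Main.v *)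
(* Write f_k for the mass function, c_i = p_i', g_k = sum_i c_i f^i_k and
   h_k = sum_(i <> j) c_i c_j f^ij_k, where f^i and f^ij omit the variables i, and
   i and j.  Then f_k' = g_(k-1) - g_k and g_k' = h_(k-1) - h_k, and summation by
   parts gives

     H'' = sum_k h_k log (f_(k+1)^2 / (f_k f_(k+2))) - sum_k (g_(k-1) - g_k)^2 / f_k.

   The crux is the identity

     2 g_k g_(k+1) f_(k+1) - g_k^2 f_(k+2) - g_(k+1)^2 f_k
       - h_k (f_(k+1)^2 - f_k f_(k+2))
     = f_(k+2) sum_i c_i^2 D_k(f^i)
       + sum_(i<j) (1 - p_i) (1 - p_j) (c_i p_j - c_j p_i)^2 T_k(f^ij),

   where D_k and T_k are the 2x2 and 3x3 Toeplitz minors centred at k, which are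
   nonnegative for Bernoulli sums.  As h_k >= 0 for c_i >= 0, the resulting bound on
   h_k and 2 log v <= v - 1/v yield

     h_k log (f_(k+1)^2 / (f_k f_(k+2)))
       <= g_k^2 / f_k + g_(k+1)^2 / f_(k+2) - 2 g_k g_(k+1) / f_(k+1),

   whose sum over k is H'' <= 0.  This applies when 0 < p_i < 1; the general case
   follows by letting e tend to 0 in (1 - 2 e) p_i + e. *)
Require Import Defs.
From Stdlib Require Import Reals Lra Lia ZArith.
Open Scope R_scope.

(** * Finite sums *)

Fixpoint rsum (n : nat) (u : nat -> R) : R :=
  match n with
  | O => 0
  | S m => rsum m u + u m
  end.

Lemma rsum_ext (n : nat) (u v : nat -> R) :
  (forall i, (i < n)%nat -> u i = v i) -> rsum n u = rsum n v.
Proof.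
  induction n as [|n IH]; intros E; simpl; trivial.
  rewrite IH, E; auto.
Qed.

Lemma rsum_plus (n : nat) (u v : nat -> R) :
  rsum n (fun i => u i + v i) = rsum n u + rsum n v.
Proof. induction n as [|n IH]; simpl; [|rewrite IH]; ring. Qed.

Lemma rsum_scal (n : nat) (x : R) (u : nat -> R) :
  rsum n (fun i => x * u i) = x * rsum n u.
Proof. induction n as [|n IH]; simpl; [|rewrite IH]; ring. Qed.

Lemma rsum_nonneg (n : nat) (u : nat -> R) :
  (forall i, (i < n)%nat -> 0 <= u i) -> 0 <= rsum n u.
Proof.
  induction n as [|n IH]; intros E; simpl; [lra|].
  assert (0 <= rsum n u) by auto.
  assert (0 <= u n) by auto.
  lra.
Qed.

Lemma rsum_exchange (m n : nat) (u : nat -> nat -> R) :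
  rsum m (fun i => rsum n (fun j => u i j)) =
  rsum n (fun j => rsum m (fun i => u i j)).
Proof.
  induction m as [|m IH]; simpl.
  - induction n as [|n IHn]; simpl; [|rewrite <- IHn]; ring.
  - rewrite IH, <- rsum_plus; reflexivity.
Qed.

(** Adding the transposed sum doubles the total, so only the symmetrized summand needs a sign. *)
Lemma rsum_symm_nonneg (n : nat) (u : nat -> nat -> R) :
  (forall i j, (i < n)%nat -> (j < n)%nat -> 0 <= u i j + u j i) ->
  0 <= rsum n (fun i => rsum n (fun j => u i j)).
Proof.
  intros E.
  assert (0 <= rsum n (fun i => rsum n (fun j => u i j + u j i))) as P.
  { apply rsum_nonneg; intros i Hi; apply rsum_nonneg; auto. }
  rewrite (rsum_ext n (fun i => rsum n (fun j => u i j + u j i))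
             (fun i => rsum n (fun j => u i j) + rsum n (fun j => u j i))) in P
    by (intros; apply rsum_plus).
  rewrite rsum_plus, (rsum_exchange n n (fun i j => u j i)) in P.
  lra.
Qed.

Lemma sum_f_R0_rsum (u : nat -> R) (n : nat) : sum_f_R0 u n = rsum (S n) u.
Proof. induction n as [|n IH]; simpl in *; [ring|rewrite IH; ring]. Qed.

(** * Bernoulli sums with a variable omitted *)

(* Setting a parameter to 0 removes its variable from the Bernoulli sum; setting
   a weight to 0 removes its term from a weighted sum. *)
Definition omit (i : nat) (p : nat -> R) (j : nat) : R :=
  if Nat.eq_dec j i then 0 else p j.

Lemma omit_eq (i : nat) (p : nat -> R) : omit i p i = 0.
Proof. unfold omit; destruct (Nat.eq_dec i i); congruence. Qed.

Lemma omit_neq (i j : nat) (p : nat -> R) : j <> i -> omit i p j = p j.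
Proof. unfold omit; destruct (Nat.eq_dec j i); congruence. Qed.

Lemma omit_comm (i j m : nat) (p : nat -> R) :
  omit i (omit j p) m = omit j (omit i p) m.
Proof.
  unfold omit; destruct (Nat.eq_dec m i), (Nat.eq_dec m j); reflexivity.
Qed.

Lemma omit_range (n i : nat) (p : nat -> R) :
  (forall j, (j < n)%nat -> 0 <= p j <= 1) ->
  forall j, (j < n)%nat -> 0 <= omit i p j <= 1.
Proof.
  intros Hp j Hj; unfold omit; destruct (Nat.eq_dec j i); [lra|auto].
Qed.

Lemma rsum_omit (n i : nat) (c u : nat -> R) :
  (i < n)%nat ->
  rsum n (fun j => c j * u j) =
  c i * u i + rsum n (fun j => omit i c j * u j).
Proof.
  induction n as [|n IH]; intros Hi; [lia|simpl].
  destruct (Nat.eq_dec i n) as [->|Ni].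
  - rewrite omit_eq.
    rewrite (rsum_ext n (fun j => omit n c j * u j) (fun j => c j * u j)).
    + ring.
    + intros j Hj; rewrite omit_neq by lia; reflexivity.
  - rewrite IH, omit_neq by lia; ring.
Qed.

(* [pmf] with integer indices, so that the recursion has no boundary case. *)
Fixpoint zpmf (p : nat -> R) (n : nat) (k : Z) : R :=
  match n with
  | O => if Z.eq_dec k 0 then 1 else 0
  | S m => (1 - p m) * zpmf p m k + p m * zpmf p m (k - 1)
  end.

Lemma zpmf_ext (p q : nat -> R) (n : nat) (k : Z) :
  (forall i, (i < n)%nat -> p i = q i) -> zpmf p n k = zpmf q n k.
Proof.
  revert k; induction n as [|n IH]; intros k E; simpl; trivial.
  rewrite (E n), !IH; auto.
Qed.

Lemma zpmf_out (p : nat -> R) (n : nat) (k : Z) :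
  (k < 0 \/ Z.of_nat n < k)%Z -> zpmf p n k = 0.
Proof.
  revert k; induction n as [|n IH]; intros k Hk; simpl zpmf.
  - destruct (Z.eq_dec k 0); [lia|reflexivity].
  - rewrite !IH by lia; ring.
Qed.

Lemma zpmf_pmf (p : nat -> R) (n k : nat) : pmf p n k = zpmf p n (Z.of_nat k).
Proof.
  revert k; induction n as [|n IH]; intros k; simpl pmf; simpl zpmf.
  - destruct k as [|k]; [reflexivity|].
    destruct (Z.eq_dec (Z.of_nat (S k)) 0); [lia|reflexivity].
  - rewrite IH; destruct k as [|k].
    + rewrite (zpmf_out p n (Z.of_nat 0 - 1)) by lia; ring.
    + rewrite IH; do 3 f_equal; lia.
Qed.

Lemma zpmf_nonneg (p : nat -> R) (n : nat) (k : Z) :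
  (forall i, (i < n)%nat -> 0 <= p i <= 1) -> 0 <= zpmf p n k.
Proof.
  revert k; induction n as [|n IH]; intros k Hp; simpl.
  - destruct (Z.eq_dec k 0); lra.
  - assert (0 <= zpmf p n k) by auto.
    assert (0 <= zpmf p n (k - 1)) by auto.
    assert (0 <= p n <= 1) by auto.
    nra.
Qed.

Lemma zpmf_pos (p : nat -> R) (n : nat) (k : Z) :
  (forall i, (i < n)%nat -> 0 < p i < 1) ->
  (0 <= k <= Z.of_nat n)%Z -> 0 < zpmf p n k.
Proof.
  revert k; induction n as [|n IH]; intros k Hp Hk; simpl zpmf.
  - destruct (Z.eq_dec k 0); [lra|lia].
  - assert (0 < p n < 1) by auto.
    assert (forall j, 0 <= zpmf p n j) as P.
    { intros j; apply zpmf_nonneg; intros i Hi.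
      assert (0 < p i < 1) by auto; lra. }
    assert (P0 := P k); assert (P1 := P (k - 1)%Z).
    destruct (Z.eq_dec k 0) as [K|K].
    + assert (0 < zpmf p n k) by (apply IH; auto; lia); nra.
    + assert (0 < zpmf p n (k - 1)) by (apply IH; auto; lia); nra.
Qed.

Lemma zpmf_omit_last (p : nat -> R) (n : nat) (k : Z) :
  zpmf (omit n p) (S n) k = zpmf p n k.
Proof.
  simpl; rewrite omit_eq.
  rewrite (zpmf_ext (omit n p) p n k) by (intros; apply omit_neq; lia).
  ring.
Qed.

(** The law does not depend on the order of the variables, so any of them can serve as the last one
    in the recursion. *)
Lemma zpmf_omit (p : nat -> R) (n i : nat) (k : Z) :
  (i < n)%nat ->
  zpmf p n k =
  (1 - p i) * zpmf (omit i p) n k + p i * zpmf (omit i p) n (k - 1).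
Proof.
  revert k; induction n as [|n IH]; intros k Hi; [lia|].
  destruct (Nat.eq_dec i n) as [->|Ni].
  - rewrite !zpmf_omit_last; reflexivity.
  - simpl; rewrite omit_neq, (IH k), (IH (k - 1)%Z) by lia; ring.
Qed.

(** * Toeplitz minors of the law *)

(** Rows [r], [s] and columns 0, 1 of the matrix with entries [x (i - j)]; [minor3] takes three rows
    and columns 0, 1, 2. *)
Definition minor2 (x : Z -> R) (r s : Z) : R :=
  x r * x (s - 1)%Z - x (r - 1)%Z * x s.

Definition minor3 (x : Z -> R) (r s t : Z) : R :=
  x r * (x (s - 1)%Z * x (t - 2)%Z - x (s - 2)%Z * x (t - 1)%Z)
  - x (r - 1)%Z * (x s * x (t - 2)%Z - x (s - 2)%Z * x t)
  + x (r - 2)%Z * (x s * x (t - 1)%Z - x (s - 1)%Z * x t).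

Lemma minor2_eq (x : Z -> R) (r : Z) : minor2 x r r = 0.
Proof. unfold minor2; ring. Qed.

Lemma minor3_eq12 (x : Z -> R) (r t : Z) : minor3 x r r t = 0.
Proof. unfold minor3; ring. Qed.

Lemma minor3_eq23 (x : Z -> R) (r s : Z) : minor3 x r s s = 0.
Proof. unfold minor3; ring. Qed.

(* Each row of a minor of the new sequence is a mixture of a row and the
   preceding row of the old one, so by multilinearity the new minors are
   nonnegative combinations of old ones, whose rows are still weakly ordered. *)
Lemma zpmf_minor2 (p : nat -> R) (n : nat) (r s : Z) :
  (forall i, (i < n)%nat -> 0 <= p i <= 1) ->
  (r <= s)%Z -> 0 <= minor2 (zpmf p n) r s.
Proof.
  revert r s; induction n as [|n IH]; intros r s Hp Hrs.
  (* For the unit mass at 0 the minor is negative only if [r = 1] and [s = 0], which the order of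
     the rows excludes. *)
  - unfold minor2; simpl.
    repeat match goal with |- context [Z.eq_dec ?a ?b] =>
      destruct (Z.eq_dec a b); try lia end; lra.
  - assert (0 <= p n <= 1) as Hn by auto.
    (* From here on [r <= s - 1], so lowering [s] alone keeps the rows in order. *)
    destruct (Z.eq_dec r s) as [<-|E]; [rewrite minor2_eq; lra|].
    set (x := p n) in *; set (y := 1 - p n).
    replace (minor2 (zpmf p (S n)) r s) with
      (y * y * minor2 (zpmf p n) r s
       + y * x * minor2 (zpmf p n) r (s - 1)
       + x * y * minor2 (zpmf p n) (r - 1) s
       + x * x * minor2 (zpmf p n) (r - 1) (s - 1))
      by (unfold minor2; simpl zpmf; unfold y, x; ring).
    assert (0 <= x /\ 0 <= y) as [X Y] by (unfold y, x in *; lra).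
    repeat apply Rplus_le_le_0_compat;
      repeat apply Rmult_le_pos; try assumption; (apply IH; [auto|lia]).
Qed.

Lemma zpmf_minor3 (p : nat -> R) (n : nat) (r s t : Z) :
  (forall i, (i < n)%nat -> 0 <= p i <= 1) ->
  (r <= s)%Z -> (s <= t)%Z -> 0 <= minor3 (zpmf p n) r s t.
Proof.
  revert r s t; induction n as [|n IH]; intros r s t Hp Hrs Hst;
    (destruct (Z.eq_dec r s) as [<-|E]; [rewrite minor3_eq12; lra|]);
    (destruct (Z.eq_dec s t) as [<-|E']; [rewrite minor3_eq23; lra|]).
  - unfold minor3; simpl.
    repeat match goal with |- context [Z.eq_dec ?a ?b] =>
      destruct (Z.eq_dec a b); try lia end; lra.
  - assert (0 <= p n <= 1) as Hn by auto.
    set (x := p n) in *; set (y := 1 - p n).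
    replace (minor3 (zpmf p (S n)) r s t) with
      (y * y * y * minor3 (zpmf p n) r s t
       + y * y * x * minor3 (zpmf p n) r s (t - 1)
       + y * x * y * minor3 (zpmf p n) r (s - 1) t
       + y * x * x * minor3 (zpmf p n) r (s - 1) (t - 1)
       + x * y * y * minor3 (zpmf p n) (r - 1) s t
       + x * y * x * minor3 (zpmf p n) (r - 1) s (t - 1)
       + x * x * y * minor3 (zpmf p n) (r - 1) (s - 1) t
       + x * x * x * minor3 (zpmf p n) (r - 1) (s - 1) (t - 1)).
    2:{ unfold minor3; simpl zpmf; unfold y, x.
        replace (s - 2 - 1)%Z with (s - 1 - 2)%Z by lia.
        replace (r - 2 - 1)%Z with (r - 1 - 2)%Z by lia.
        replace (t - 2 - 1)%Z with (t - 1 - 2)%Z by lia.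
        replace (s - 1 - 1)%Z with (s - 2)%Z by lia.
        replace (r - 1 - 1)%Z with (r - 2)%Z by lia.
        replace (t - 1 - 1)%Z with (t - 2)%Z by lia.
        ring. }
    assert (0 <= x /\ 0 <= y) as [X Y] by (unfold y, x in *; lra).
    repeat apply Rplus_le_le_0_compat;
      repeat apply Rmult_le_pos; try assumption; (apply IH; [auto|lia|lia]).
Qed.

(* The 2x2 and 3x3 Toeplitz minors with diagonal entry [x k]. *)
Definition toep2 (x : Z -> R) (k : Z) : R := minor2 x k (k + 1).
Definition toep3 (x : Z -> R) (k : Z) : R := minor3 x k (k + 1) (k + 2).

Lemma toep2_eq (x : Z -> R) (k : Z) :
  toep2 x k = x k * x k - x (k - 1)%Z * x (k + 1)%Z.
Proof.
  unfold toep2, minor2; replace (k + 1 - 1)%Z with k by lia; reflexivity.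
Qed.

Lemma toep3_eq (x : Z -> R) (k : Z) :
  toep3 x k =
  x k * (x k * x k - x (k - 1)%Z * x (k + 1)%Z)
  - x (k - 1)%Z * (x (k + 1)%Z * x k - x (k - 1)%Z * x (k + 2)%Z)
  + x (k - 2)%Z * (x (k + 1)%Z * x (k + 1)%Z - x k * x (k + 2)%Z).
Proof.
  unfold toep3, minor3.
  replace (k + 1 - 1)%Z with k by lia.
  replace (k + 2 - 2)%Z with k by lia.
  replace (k + 1 - 2)%Z with (k - 1)%Z by lia.
  replace (k + 2 - 1)%Z with (k + 1)%Z by lia.
  reflexivity.
Qed.

Lemma zpmf_toep2 (p : nat -> R) (n : nat) (k : Z) :
  (forall i, (i < n)%nat -> 0 <= p i <= 1) -> 0 <= toep2 (zpmf p n) k.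
Proof. intros Hp; apply zpmf_minor2; [assumption|lia]. Qed.

Lemma zpmf_toep3 (p : nat -> R) (n : nat) (k : Z) :
  (forall i, (i < n)%nat -> 0 <= p i <= 1) -> 0 <= toep3 (zpmf p n) k.
Proof. intros Hp; apply zpmf_minor3; [assumption|lia|lia]. Qed.

(** * First and second flux of the law *)

(* If the parameters move with velocities [c], the law [zpmf p n] obeys the
   continuity equation with flux [flux c p n], and the flux obeys it with
   [flux2 c p n]. *)
Definition flux (c p : nat -> R) (n : nat) (k : Z) : R :=
  rsum n (fun i => c i * zpmf (omit i p) n k).

Definition flux2 (c p : nat -> R) (n : nat) (k : Z) : R :=
  rsum n (fun i => c i * flux (omit i c) (omit i p) n k).

Lemma flux_ext (c d p q : nat -> R) (n : nat) (k : Z) :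
  (forall i, (i < n)%nat -> c i = d i) ->
  (forall i, (i < n)%nat -> p i = q i) -> flux c p n k = flux d q n k.
Proof.
  intros E E'; apply rsum_ext; intros i Hi; rewrite E by assumption.
  f_equal; apply zpmf_ext; intros j Hj; unfold omit.
  destruct (Nat.eq_dec j i); auto.
Qed.

Lemma flux_S (c p : nat -> R) (n : nat) (k : Z) :
  flux c p (S n) k =
  (1 - p n) * flux c p n k + p n * flux c p n (k - 1) + c n * zpmf p n k.
Proof.
  unfold flux; rewrite <- !rsum_scal, <- rsum_plus.
  change (rsum (S n) ?u) with (rsum n u + u n); cbv beta.
  rewrite zpmf_omit_last; f_equal.
  apply rsum_ext; intros i Hi; simpl.
  rewrite omit_neq by lia; ring.
Qed.

(** The factor 2 counts the ordered pairs [(i, n)] and [(n, i)]. *)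
Lemma flux2_S (c p : nat -> R) (n : nat) (k : Z) :
  flux2 c p (S n) k =
  (1 - p n) * flux2 c p n k + p n * flux2 c p n (k - 1)
  + 2 * c n * flux c p n k.
Proof.
  unfold flux2.
  change (rsum (S n) ?u) with (rsum n u + u n); cbv beta.
  replace (flux (omit n c) (omit n p) (S n) k) with (flux c p n k).
  2:{ rewrite flux_S, !omit_eq.
      rewrite (flux_ext (omit n c) c (omit n p) p n k)
        by (intros; apply omit_neq; lia); ring. }
  replace (rsum n (fun i => c i * flux (omit i c) (omit i p) (S n) k)) with
    ((1 - p n) * flux2 c p n k + p n * flux2 c p n (k - 1)
     + c n * flux c p n k); [unfold flux2; ring|].
  unfold flux2; unfold flux at 3.
  rewrite <- !rsum_scal, <- !rsum_plus.
  apply rsum_ext; intros i Hi; rewrite flux_S, !omit_neq by lia; ring.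
Qed.

(** Each term omits one variable, so its law lives on 0, ..., n - 1; two variables are omitted in
    [flux2], whence the bound n - 2 there. *)
Lemma flux_out (c p : nat -> R) (n : nat) (k : Z) :
  (k < 0 \/ Z.of_nat n <= k)%Z -> flux c p n k = 0.
Proof.
  revert k; induction n as [|n IH]; intros k Hk; [reflexivity|].
  rewrite flux_S, !IH, zpmf_out by lia; ring.
Qed.

Lemma flux2_out (c p : nat -> R) (n : nat) (k : Z) :
  (k < 0 \/ Z.of_nat n <= k + 1)%Z -> flux2 c p n k = 0.
Proof.
  revert k; induction n as [|n IH]; intros k Hk; [reflexivity|].
  rewrite flux2_S, !IH, flux_out by lia; ring.
Qed.

Lemma omit_nonneg (n i : nat) (c : nat -> R) :
  (forall j, (j < n)%nat -> 0 <= c j) ->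
  forall j, (j < n)%nat -> 0 <= omit i c j.
Proof.
  intros Hp j Hj; unfold omit; destruct (Nat.eq_dec j i); [lra|auto].
Qed.

Lemma flux_nonneg (c p : nat -> R) (n : nat) (k : Z) :
  (forall i, (i < n)%nat -> 0 <= c i) ->
  (forall i, (i < n)%nat -> 0 <= p i <= 1) -> 0 <= flux c p n k.
Proof.
  intros Hc Hp; apply rsum_nonneg; intros i Hi; apply Rmult_le_pos; auto.
  apply zpmf_nonneg, omit_range; assumption.
Qed.

Lemma flux2_nonneg (c p : nat -> R) (n : nat) (k : Z) :
  (forall i, (i < n)%nat -> 0 <= c i) ->
  (forall i, (i < n)%nat -> 0 <= p i <= 1) -> 0 <= flux2 c p n k.
Proof.
  intros Hc Hp; apply rsum_nonneg; intros i Hi; apply Rmult_le_pos; auto.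
  apply flux_nonneg; [apply omit_nonneg|apply omit_range]; assumption.
Qed.

(** * The determinant identity *)

(* Compare coefficients in [z * P'(z) = sum_i p_i z P(z) / (1 - p_i + p_i z)]
   for the generating polynomial [P] of [zpmf p n]. *)
Lemma flux_param (p : nat -> R) (n : nat) (k : Z) :
  flux p p n k = IZR (k + 1) * zpmf p n (k + 1).
Proof.
  revert k; induction n as [|n IH]; intros k.
  - unfold flux; simpl.
    destruct (Z.eq_dec (k + 1) 0) as [E|E]; [rewrite E; ring|ring].
  - rewrite flux_S, !IH; simpl.
    replace (k - 1 + 1)%Z with k by lia.
    replace (k + 1 - 1)%Z with k by lia.
    rewrite plus_IZR; ring.
Qed.

(* [p_j^2 (1 - p_j) T_k(f^j)] is the determinant of the rows [k+1] and [k+2] of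
   [f] and, between them, the row [k+1] of [p_j f^j]; the latter rows are summed
   with [flux_param]. *)
Lemma sum_toep3 (p : nat -> R) (n : nat) (k : Z) :
  rsum n (fun j => p j * p j * (1 - p j) * toep3 (zpmf (omit j p) n) k) =
  zpmf p n k * toep2 (zpmf p n) (k + 1)
  - zpmf p n (k + 2) * toep2 (zpmf p n) k.
Proof.
  rewrite !toep2_eq.
  replace (k + 1 - 1)%Z with k by lia.
  replace (k + 1 + 1)%Z with (k + 2)%Z by lia.
  set (f := zpmf p n).
  assert (forall m, rsum n (fun j => p j * zpmf (omit j p) n m) =
    IZR (m + 1) * f (m + 1)%Z) as S by (intros m; apply flux_param).
  rewrite (rsum_ext n _ (fun j =>
    (f k * f k - f (k - 1)%Z * f (k + 1)%Z)
      * - (p j * zpmf (omit j p) n (k + 1))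
    + (f (k + 1)%Z * f k - f (k - 1)%Z * f (k + 2)%Z)
      * (p j * zpmf (omit j p) n k)
    + (f (k + 1)%Z * f (k + 1)%Z - f k * f (k + 2)%Z)
      * - (p j * zpmf (omit j p) n (k - 1)))).
  2:{ intros j Hj; rewrite toep3_eq; unfold f.
      rewrite (zpmf_omit p n j k), (zpmf_omit p n j (k - 1)),
        (zpmf_omit p n j (k + 1)), (zpmf_omit p n j (k + 2)) by assumption.
      replace (k + 1 - 1)%Z with k by lia.
      replace (k + 2 - 1)%Z with (k + 1)%Z by lia.
      replace (k - 1 - 1)%Z with (k - 2)%Z by lia.
      ring. }
  rewrite !rsum_plus, !rsum_scal.
  rewrite (rsum_ext n (fun j => - (p j * zpmf (omit j p) n (k + 1)))
    (fun j => -1 * (p j * zpmf (omit j p) n (k + 1)))) by (intros; ring).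
  rewrite (rsum_ext n (fun j => - (p j * zpmf (omit j p) n (k - 1)))
    (fun j => -1 * (p j * zpmf (omit j p) n (k - 1)))) by (intros; ring).
  rewrite !rsum_scal, !S.
  replace (k + 1 + 1)%Z with (k + 2)%Z by lia.
  replace (k - 1 + 1)%Z with k by lia.
  rewrite !plus_IZR; ring.
Qed.

(* Coefficient of [c_i c_j] in the quadratic form of [flux_det_eq]. *)
Lemma cross_coeff (p : nat -> R) (n i j : nat) (k : Z) :
  (i < n)%nat -> (j < n)%nat -> j <> i ->
  zpmf (omit i p) n k * zpmf (omit j p) n (k + 1) * zpmf p n (k + 1)
  + zpmf (omit i p) n (k + 1) * zpmf (omit j p) n k * zpmf p n (k + 1)
  - zpmf (omit i p) n k * zpmf (omit j p) n k * zpmf p n (k + 2)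
  - zpmf (omit i p) n (k + 1) * zpmf (omit j p) n (k + 1) * zpmf p n k
  - zpmf (omit j (omit i p)) n k * toep2 (zpmf p n) (k + 1) =
  - (p i * (1 - p i) * (p j * (1 - p j)) * toep3 (zpmf (omit j (omit i p)) n) k).
Proof.
  intros Hi Hj N.
  rewrite toep2_eq, toep3_eq.
  replace (k + 1 - 1)%Z with k by lia.
  replace (k + 1 + 1)%Z with (k + 2)%Z by lia.
  (* Every law is expressed through that of [omit j (omit i p)] at the indices k - 2, ..., k + 2;
     the claim is then a polynomial identity. *)
  assert (forall m, zpmf (omit i p) n m =
    (1 - p j) * zpmf (omit j (omit i p)) n m
    + p j * zpmf (omit j (omit i p)) n (m - 1)) as Ei.
  { intros m; rewrite (zpmf_omit (omit i p) n j m) by assumption.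
    rewrite omit_neq by assumption; reflexivity. }
  assert (forall m, zpmf (omit j p) n m =
    (1 - p i) * zpmf (omit j (omit i p)) n m
    + p i * zpmf (omit j (omit i p)) n (m - 1)) as Ej.
  { intros m; rewrite (zpmf_omit (omit j p) n i m) by assumption.
    rewrite omit_neq by auto.
    rewrite !(zpmf_ext (omit i (omit j p)) (omit j (omit i p)))
      by (intros; apply omit_comm); reflexivity. }
  assert (forall m, zpmf p n m = (1 - p i) * zpmf (omit i p) n m
    + p i * zpmf (omit i p) n (m - 1)) as E.
  { intros m; apply zpmf_omit; assumption. }
  rewrite !E, !Ei, !Ej.
  replace (k + 1 - 1)%Z with k by lia.
  replace (k + 2 - 1)%Z with (k + 1)%Z by lia.
  replace (k + 1 - 1)%Z with k by lia.
  replace (k - 1 - 1)%Z with (k - 2)%Z by lia.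
  ring.
Qed.

(* The left-hand side is the determinant of the symmetric matrix with rows
   [(h_k, g_k, g_{k+1})], [(g_k, f_k, f_{k+1})] and [(g_{k+1}, f_{k+1}, f_{k+2})],
   where [f = zpmf p n], [g = flux c p n] and [h = flux2 c p n]. *)
Lemma flux_det_eq (c p : nat -> R) (n : nat) (k : Z) :
  2 * flux c p n k * flux c p n (k + 1) * zpmf p n (k + 1)
  - flux c p n k * flux c p n k * zpmf p n (k + 2)
  - flux c p n (k + 1) * flux c p n (k + 1) * zpmf p n k
  - flux2 c p n k * toep2 (zpmf p n) (k + 1) =
  zpmf p n (k + 2) * rsum n (fun i => c i * c i * toep2 (zpmf (omit i p) n) k)
  + rsum n (fun i => rsum n (fun j =>
      (c i * c i * (1 - p i)
         * (omit i p j * omit i p j * (1 - omit i p j))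
       - c i * omit i c j * (p i * (1 - p i) * (p j * (1 - p j))))
      * toep3 (zpmf (omit j (omit i p)) n) k)).
Proof.
  set (f := zpmf p n).
  (* [w i j] is the symmetrized coefficient of [c i * c j] in the three terms quadratic in
     [flux]. *)
  pose (w i j := zpmf (omit i p) n k * zpmf (omit j p) n (k + 1) * f (k + 1)%Z
    + zpmf (omit i p) n (k + 1) * zpmf (omit j p) n k * f (k + 1)%Z
    - zpmf (omit i p) n k * zpmf (omit j p) n k * f (k + 2)%Z
    - zpmf (omit i p) n (k + 1) * zpmf (omit j p) n (k + 1) * f k).
  transitivity (rsum n (fun i => c i * (rsum n (fun j => c j * w i j)
     - toep2 f (k + 1) *
       rsum n (fun j => omit i c j * zpmf (omit j (omit i p)) n k)))).
  { unfold flux2.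
    rewrite (rsum_ext n (fun i => c i * (rsum n (fun j => c j * w i j) - _))
      (fun i => c i * rsum n (fun j => c j * w i j)
        + - toep2 f (k + 1) * (c i * flux (omit i c) (omit i p) n k)))
      by (intros; unfold flux; ring).
    rewrite rsum_plus, rsum_scal.
    rewrite (rsum_ext n (fun i => c i * rsum n (fun j => c j * w i j))
      (fun i =>
        f (k + 1)%Z * (flux c p n (k + 1) * (c i * zpmf (omit i p) n k))
        + f (k + 1)%Z * (flux c p n k * (c i * zpmf (omit i p) n (k + 1)))
        + - f (k + 2)%Z * (flux c p n k * (c i * zpmf (omit i p) n k))
        + - f k * (flux c p n (k + 1) * (c i * zpmf (omit i p) n (k + 1))))).
    2:{ intros i Hi; unfold flux.
        rewrite (rsum_ext n (fun j => c j * w i j) (fun j =>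
          f (k + 1)%Z * zpmf (omit i p) n k * (c j * zpmf (omit j p) n (k + 1))
          + f (k + 1)%Z * zpmf (omit i p) n (k + 1) * (c j * zpmf (omit j p) n k)
          + - f (k + 2)%Z * zpmf (omit i p) n k * (c j * zpmf (omit j p) n k)
          + - f k * zpmf (omit i p) n (k + 1)
            * (c j * zpmf (omit j p) n (k + 1))))
          by (intros; unfold w; ring).
        rewrite !rsum_plus, !rsum_scal; ring. }
    rewrite !rsum_plus, !rsum_scal.
    fold (flux c p n k); fold (flux c p n (k + 1)); ring. }
  rewrite <- rsum_scal, <- rsum_plus.
  apply rsum_ext; intros i Hi.
  (* The diagonal term is split off, since [cross_coeff] covers only [j <> i]. *)
  rewrite (rsum_omit n i c (w i)) by assumption.
  rewrite (rsum_ext n (fun j => (c i * c i * (1 - p i) * _ - _) * _) (fun j =>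
    c i * c i * (1 - p i) * (omit i p j * omit i p j * (1 - omit i p j)
      * toep3 (zpmf (omit j (omit i p)) n) k)
    + c i * (omit i c j * w i j
        + - toep2 f (k + 1) * (omit i c j * zpmf (omit j (omit i p)) n k)))).
  2:{ intros j Hj; destruct (Nat.eq_dec j i) as [->|N].
      - rewrite !omit_eq; ring.
      - replace (w i j) with (toep2 f (k + 1) * zpmf (omit j (omit i p)) n k
          - p i * (1 - p i) * (p j * (1 - p j))
            * toep3 (zpmf (omit j (omit i p)) n) k).
        + ring.
        + assert (X := cross_coeff p n i j k Hi Hj N).
          unfold w; fold f in X; lra. }
  (* The cross terms cancel. For the coefficient of [c i * c i], [sum_toep3] at [omit i p] evaluates
     the sum of 3x3 minors, leaving an identity in the law of [omit i p]. *)
  rewrite rsum_plus, !rsum_scal, rsum_plus, rsum_scal, sum_toep3.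
  assert (forall m, f m = (1 - p i) * zpmf (omit i p) n m
    + p i * zpmf (omit i p) n (m - 1)) as E
    by (intros m; apply zpmf_omit; assumption).
  unfold w; rewrite !toep2_eq, !E.
  replace (k + 2 - 1)%Z with (k + 1)%Z by lia.
  replace (k + 1 - 1)%Z with k by lia.
  replace (k + 1 + 1)%Z with (k + 2)%Z by lia.
  replace (k + 2 - 1)%Z with (k + 1)%Z by lia.
  ring.
Qed.

(** The double sum in [flux_det_eq] need not be nonnegative term by term, but the terms for [(i, j)]
    and [(j, i)] combine into a square times a 3x3 minor. *)
Lemma flux_det_nonneg (c p : nat -> R) (n : nat) (k : Z) :
  (forall i, (i < n)%nat -> 0 <= p i <= 1) ->
  flux2 c p n k * toep2 (zpmf p n) (k + 1) <=
  2 * flux c p n k * flux c p n (k + 1) * zpmf p n (k + 1)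
  - flux c p n k * flux c p n k * zpmf p n (k + 2)
  - flux c p n (k + 1) * flux c p n (k + 1) * zpmf p n k.
Proof.
  intros Hp; apply Rge_le, Rminus_ge, Rle_ge; rewrite flux_det_eq.
  apply Rplus_le_le_0_compat.
  - apply Rmult_le_pos; [apply zpmf_nonneg; assumption|].
    apply rsum_nonneg; intros i Hi; apply Rmult_le_pos; [nra|].
    apply zpmf_toep2, omit_range; assumption.
  - apply rsum_symm_nonneg; intros i j Hi Hj.
    destruct (Nat.eq_dec j i) as [->|N]; [rewrite !omit_eq; lra|].
    replace (toep3 (zpmf (omit i (omit j p)) n) k)
      with (toep3 (zpmf (omit j (omit i p)) n) k).
    2:{ rewrite !toep3_eq.
        rewrite !(zpmf_ext (omit i (omit j p)) (omit j (omit i p)))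
          by (intros; apply omit_comm); reflexivity. }
    rewrite !omit_neq by auto.
    replace (_ + _) with
      ((1 - p i) * (1 - p j) * Rsqr (c i * p j - c j * p i)
        * toep3 (zpmf (omit j (omit i p)) n) k) by (unfold Rsqr; ring).
    assert (0 <= p i <= 1) by auto.
    assert (0 <= p j <= 1) by auto.
    apply Rmult_le_pos; [apply Rmult_le_pos; [nra|apply Rle_0_sqr]|].
    apply zpmf_toep3, omit_range, omit_range; assumption.
Qed.

(** * The logarithmic inequality at one index *)

Lemma ln_le_sub_1 (x : R) : 0 < x -> ln x <= x - 1.
Proof.
  intros Hx; assert (E := exp_ineq1_le (ln x)); rewrite exp_ln in E; lra.
Qed.

Lemma derivable_pt_lim_eq (u : R -> R) (t d e : R) :
  d = e -> derivable_pt_lim u t d -> derivable_pt_lim u t e.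
Proof. intros <-; trivial. Qed.

(** The function x - 1/x - 2 ln x vanishes at 1 and has derivative (1 - 1/x)^2. *)
Lemma two_ln_le (v : R) : 1 <= v -> 2 * ln v <= v - / v.
Proof.
  intros [Hv|<-]; [|rewrite ln_1; lra].
  destruct (MVT_cor2 (fun x => x - 1 / x - 2 * ln x)
              (fun x => 1 - - / (x * x) - 2 * / x) 1 v Hv) as [w [E W]].
  - intros x Hx.
    apply (derivable_pt_lim_minus (fun x => x - 1 / x) (fun x => 2 * ln x)).
    + apply (derivable_pt_lim_minus (fun x => x) (fun x => 1 / x)).
      * apply derivable_pt_lim_id.
      * apply (derivable_pt_lim_eq _ _ ((0 * x - 1 * 1) / Rsqr x)).
        { unfold Rsqr; field; lra. }
        apply (derivable_pt_lim_div (fun _ => 1) (fun x => x)).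
        { apply derivable_pt_lim_const. }
        { apply derivable_pt_lim_id. }
        { lra. }
    + apply (derivable_pt_lim_scal ln 2), derivable_pt_lim_ln; lra.
  - rewrite ln_1, Rdiv_1_r in E; unfold Rdiv in E; rewrite Rmult_1_l in E.
    replace (1 - - / (w * w) - 2 * / w) with (Rsqr (1 - / w)) in E
      by (unfold Rsqr; field; lra).
    assert (P := Rle_0_sqr (1 - / w)); nra.
Qed.

(* With [v = f1 / s] and [s = sqrt (f0 f2)], the left-hand side is
   [2 h ln v <= h (v - 1 / v) = h (f1^2 - s^2) / (f1 s)], and the hypothesis and
   AM-GM bound this by [2 g0 g1 (1 / s - 1 / f1)], then by the right-hand side. *)
Lemma local_bound (f0 f1 f2 g0 g1 h : R) :
  0 < f0 -> 0 < f1 -> 0 < f2 -> 0 <= h -> f0 * f2 <= f1 * f1 ->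
  h * (f1 * f1 - f0 * f2) <= 2 * g0 * g1 * f1 - g0 * g0 * f2 - g1 * g1 * f0 ->
  h * (2 * ln f1 - ln f0 - ln f2) <=
  g0 * g0 / f0 + g1 * g1 / f2 - 2 * (g0 * g1 / f1).
Proof.
  intros F0 F1 F2 Hh L Q.
  set (s := sqrt (f0 * f2)).
  assert (0 < f0 * f2) as F02 by nra.
  assert (0 < s) as S by (apply sqrt_lt_R0; assumption).
  assert (s * s = f0 * f2) as S2 by (apply sqrt_def; lra).
  assert (s <= f1) as Sf by nra.
  assert (1 <= f1 / s) as V.
  { apply (Rmult_le_reg_r s); [assumption|].
    unfold Rdiv; rewrite Rmult_assoc, Rinv_l; lra. }
  replace (2 * ln f1 - ln f0 - ln f2) with (2 * ln (f1 / s)).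
  2:{ unfold Rdiv; rewrite ln_mult, ln_Rinv
        by (try apply Rinv_0_lt_compat; assumption).
      assert (ln s + ln s = ln f0 + ln f2)
        by (rewrite <- !ln_mult, S2 by assumption; reflexivity).
      lra. }
  assert (B := two_ln_le _ V).
  assert (0 <= Rsqr (g0 * f2 - g1 * s)) as A by apply Rle_0_sqr.
  (* AM-GM: this is the square [A] divided by [f2], as s^2 = f0 f2. *)
  assert (2 * g0 * g1 * s <= g0 * g0 * f2 + g1 * g1 * f0) as AG.
  { apply (Rmult_le_reg_r f2); [assumption|].
    unfold Rsqr in A; nra. }
  apply (Rle_trans _ (h * (f1 / s - / (f1 / s)))).
  { apply Rmult_le_compat_l; assumption. }
  apply (Rmult_le_reg_r (f1 * (s * s))); [apply Rmult_lt_0_compat; nra|].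
  replace (h * (f1 / s - / (f1 / s)) * (f1 * (s * s)))
    with (s * (h * (f1 * f1 - s * s))) by (field; split; lra).
  rewrite S2.
  replace ((g0 * g0 / f0 + g1 * g1 / f2 - 2 * (g0 * g1 / f1)) * (f1 * (f0 * f2)))
    with ((g0 * g0 * f2 + g1 * g1 * f0) * f1 - 2 * g0 * g1 * (f0 * f2))
    by (field; repeat split; lra).
  rewrite <- S2 at 2.
  apply (Rmult_le_compat_l s) in Q; [|lra].
  (* Once [Q] has bounded the left-hand side, the difference of the two sides is [f1 + s] times the
     AM-GM gap. *)
  assert (0 <= (f1 + s) * (g0 * g0 * f2 + g1 * g1 * f0 - 2 * g0 * g1 * s))
    by (apply Rmult_le_pos; lra).
  lra.
Qed.

(** * Summation by parts and the sign of the second derivative *)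

Lemma rsum_shift (n : nat) (u : Z -> R) :
  u (-1)%Z = 0 -> u (Z.of_nat n) = 0 ->
  rsum (S n) (fun k => u (Z.of_nat k - 1)%Z) =
  rsum (S n) (fun k => u (Z.of_nat k)).
Proof.
  intros U0 Un; simpl rsum at 2; rewrite Un, Rplus_0_r; clear Un.
  induction n as [|n IH].
  - simpl; rewrite U0; ring.
  - change (rsum (S (S n)) ?v) with (rsum (S n) v + v (S n)); cbv beta.
    rewrite IH; replace (Z.of_nat (S n) - 1)%Z with (Z.of_nat n) by lia; reflexivity.
Qed.

Lemma rsum_shift_le (n : nat) (u : Z -> R) :
  0 <= u 0%Z -> u (Z.of_nat (S n)) = 0 ->
  rsum (S n) (fun k => u (Z.of_nat k + 1)%Z) <=
  rsum (S n) (fun k => u (Z.of_nat k)).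
Proof.
  intros U0 Un.
  assert (forall m, rsum m (fun k => u (Z.of_nat k)) + u (Z.of_nat m) =
    u 0%Z + rsum m (fun k => u (Z.of_nat k + 1)%Z)) as E.
  { induction m as [|m IH]; [simpl; ring|].
    simpl rsum; rewrite IH.
    replace (Z.of_nat (S m)) with (Z.of_nat m + 1)%Z by lia; ring. }
  assert (X := E (S n)); lra.
Qed.

(* Summation by parts reduces this to [local_bound] for each [k]. *)
Lemma entropy_dissipation (c p : nat -> R) (n : nat) :
  (forall i, (i < n)%nat -> 0 <= c i) ->
  (forall i, (i < n)%nat -> 0 < p i < 1) ->
  0 <= rsum (S n) (fun k =>
    (flux2 c p n (Z.of_nat k - 1 - 1) - flux2 c p n (Z.of_nat k - 1)
     - (flux2 c p n (Z.of_nat k - 1) - flux2 c p n (Z.of_nat k)))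
      * (ln (zpmf p n (Z.of_nat k)) + 1)
    + (flux c p n (Z.of_nat k - 1) - flux c p n (Z.of_nat k))
      * (flux c p n (Z.of_nat k - 1) - flux c p n (Z.of_nat k))
      / zpmf p n (Z.of_nat k)).
Proof.
  intros Hc Hp.
  assert (forall i, (i < n)%nat -> 0 <= p i <= 1) as Hp'.
  { intros i Hi; assert (0 < p i < 1) by auto; lra. }
  set (f := zpmf p n); set (g := flux c p n); set (h := flux2 c p n).
  assert (forall k, (k < 0 \/ Z.of_nat n <= k)%Z -> g k = 0) as g0
    by (intros; apply flux_out; assumption).
  assert (forall k, (k < 0 \/ Z.of_nat n <= k + 1)%Z -> h k = 0) as h0
    by (intros; apply flux2_out; assumption).
  pose (l k := ln (f k) + 1).
  (* Each product becomes a function of one index, so that a whole sum can be shifted; the term with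
     [h] at k - 2 is shifted twice, through [u0] and then [u1]. *)
  pose (u0 k := h (k - 1)%Z * l (k + 1)%Z).
  pose (u1 k := h k * l (k + 2)%Z).
  pose (u2 k := h k * l (k + 1)%Z).
  pose (u3 k := g k * g k / f (k + 1)%Z).
  pose (u4 k := g k * g (k + 1)%Z / f (k + 1)%Z).
  pose (u5 k := g k * g k / f k).
  rewrite (rsum_ext (S n) _ (fun k =>
    u0 (Z.of_nat k - 1)%Z + -2 * u2 (Z.of_nat k - 1)%Z
    + h (Z.of_nat k) * l (Z.of_nat k)
    + u3 (Z.of_nat k - 1)%Z + -2 * u4 (Z.of_nat k - 1)%Z + u5 (Z.of_nat k))).
  2:{ intros k _; unfold u0, u2, u3, u4, u5, l.
      replace (Z.of_nat k - 1 + 1)%Z with (Z.of_nat k) by lia.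
      unfold Rdiv; ring. }
  rewrite !rsum_plus, !rsum_scal.
  rewrite (rsum_shift n u0), (rsum_shift n u2), (rsum_shift n u3), (rsum_shift n u4)
    by (unfold u0, u2, u3, u4, Rdiv; rewrite ?g0, ?h0 by lia; ring).
  rewrite (rsum_ext (S n) (fun k => u0 (Z.of_nat k))
    (fun k => u1 (Z.of_nat k - 1)%Z)).
  2:{ intros k _; unfold u0, u1; do 2 f_equal; lia. }
  rewrite (rsum_shift n u1) by (unfold u1; rewrite h0 by lia; ring).
  (* The one shift that loses something: it drops g_0^2 / f_1 to reach the term g_(k+1)^2 / f_(k+2)
     of [local_bound]. For n = 0 the denominator f_1 is 0, but then g_0 = 0 too. *)
  assert (rsum (S n) (fun k => u3 (Z.of_nat k + 1)%Z) <=
    rsum (S n) (fun k => u3 (Z.of_nat k))) as L3.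
  { apply rsum_shift_le.
    - unfold u3; destruct (Nat.eq_dec n 0) as [->|N].
      + rewrite g0 by lia; unfold Rdiv; lra.
      + apply Rmult_le_pos; [apply Rle_0_sqr|].
        apply Rlt_le, Rinv_0_lt_compat, zpmf_pos; [assumption|lia].
    - unfold u3, Rdiv; rewrite g0 by lia; ring. }
  apply (Rle_trans _ (rsum (S n) (fun k =>
    u1 (Z.of_nat k) + -2 * u2 (Z.of_nat k) + h (Z.of_nat k) * l (Z.of_nat k)
    + u3 (Z.of_nat k + 1)%Z + -2 * u4 (Z.of_nat k) + u5 (Z.of_nat k)))).
  2:{ rewrite !rsum_plus, !rsum_scal; lra. }
  clear L3; apply rsum_nonneg; intros k' _.
  assert (0 <= Z.of_nat k')%Z as Hk by lia.
  set (k := Z.of_nat k') in *; clearbody k; clear k'.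
  unfold u1, u2, u3, u4, u5.
  replace (k + 1 + 1)%Z with (k + 2)%Z by lia.
  (* If k + 2 <= n, all three masses are positive and [local_bound] applies; otherwise h_k = g_(k+1)
     = 0 and only g_k^2 / f_k remains. *)
  destruct (Z_lt_le_dec (k + 1) (Z.of_nat n)) as [K|K].
  - assert (forall m, (0 <= m <= Z.of_nat n)%Z -> 0 < f m) as F
      by (intros; apply zpmf_pos; assumption).
    assert (L := zpmf_toep2 p n (k + 1) Hp'); fold f in L.
    assert (Q := flux_det_nonneg c p n k Hp'); fold f g h in Q.
    rewrite toep2_eq in L, Q.
    replace (k + 1 - 1)%Z with k in L, Q by lia.
    replace (k + 1 + 1)%Z with (k + 2)%Z in L, Q by lia.
    assert (B : h k * (2 * ln (f (k + 1)%Z) - ln (f k) - ln (f (k + 2)%Z)) <=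
      g k * g k / f k + g (k + 1)%Z * g (k + 1)%Z / f (k + 2)%Z
      - 2 * (g k * g (k + 1)%Z / f (k + 1)%Z)).
    { apply local_bound; try (apply F; lia); try lra.
      apply flux2_nonneg; assumption. }
    (* The constants 1 in [l] cancel in the second difference. *)
    unfold l; lra.
  - rewrite (h0 k), (g0 (k + 1)%Z) by lia.
    assert (0 <= g k * g k / f k).
    { destruct (Z_lt_le_dec k (Z.of_nat n)) as [K'|K'].
      - apply Rmult_le_pos; [apply Rle_0_sqr|].
        apply Rlt_le, Rinv_0_lt_compat, zpmf_pos; [assumption|lia].
      - rewrite (g0 k) by lia; unfold Rdiv; lra. }
    unfold Rdiv in *; lra.
Qed.

(** * Derivatives of the law, the flux and the entropy summand *)

(** The recursions for [zpmf] and [flux] are mixtures of this shape; the last term of the derivative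
    produces the new flux contribution. *)
Lemma derivable_pt_lim_mix (x u v : R -> R) (t x' u' v' : R) :
  derivable_pt_lim x t x' -> derivable_pt_lim u t u' ->
  derivable_pt_lim v t v' ->
  derivable_pt_lim (fun s => (1 - x s) * u s + x s * v s) t
    ((1 - x t) * u' + x t * v' + x' * (v t - u t)).
Proof.
  intros X U V.
  apply (derivable_pt_lim_eq _ _
    (((0 - x') * u t + (1 - x t) * u') + (x' * v t + x t * v'))); [ring|].
  apply (derivable_pt_lim_plus (fun s => (1 - x s) * u s) (fun s => x s * v s)).
  - apply (derivable_pt_lim_mult (fun s => 1 - x s) u); [|assumption].
    apply (derivable_pt_lim_minus (fun _ => 1) x); [|assumption].
    apply derivable_pt_lim_const.
  - apply (derivable_pt_lim_mult x v); assumption.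
Qed.

Lemma derivable_pt_lim_rsum (n : nat) (u : nat -> R -> R) (t : R) (d : nat -> R) :
  (forall i, (i < n)%nat -> derivable_pt_lim (u i) t (d i)) ->
  derivable_pt_lim (fun s => rsum n (fun i => u i s)) t (rsum n d).
Proof.
  induction n as [|n IH]; intros D; simpl.
  - apply derivable_pt_lim_const.
  - apply (derivable_pt_lim_plus (fun s => rsum n (fun i => u i s)) (u n)); auto.
Qed.

Lemma zpmf_derivative (x : R -> nat -> R) (c : nat -> R) (t : R) (n : nat) (k : Z) :
  (forall i, (i < n)%nat -> derivable_pt_lim (fun s => x s i) t (c i)) ->
  derivable_pt_lim (fun s => zpmf (x s) n k) t
    (flux c (x t) n (k - 1) - flux c (x t) n k).
Proof.
  revert k; induction n as [|n IH]; intros k D.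
  - apply (derivable_pt_lim_eq _ _ 0); [unfold flux; simpl; ring|].
    simpl; apply derivable_pt_lim_const.
  - simpl zpmf; rewrite !flux_S.
    eapply derivable_pt_lim_eq; [|apply derivable_pt_lim_mix; auto].
    cbv beta; ring.
Qed.

(** With constant weights, the term [2 * c n] of [flux2_S] arises once from the moving parameter
    [x s n] and once from differentiating [c n * zpmf (x s) n k]. *)
Lemma flux_derivative (x : R -> nat -> R) (c : nat -> R) (t : R) (n : nat) (k : Z) :
  (forall i, (i < n)%nat -> derivable_pt_lim (fun s => x s i) t (c i)) ->
  derivable_pt_lim (fun s => flux c (x s) n k) t
    (flux2 c (x t) n (k - 1) - flux2 c (x t) n k).
Proof.
  revert k; induction n as [|n IH]; intros k D.
  - apply (derivable_pt_lim_eq _ _ 0); [unfold flux2; simpl; ring|].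
    apply (derivable_pt_lim_const 0).
  - rewrite !flux2_S.
    apply (derivable_pt_lim_ext (fun s => (1 - x s n) * flux c (x s) n k
      + x s n * flux c (x s) n (k - 1) + c n * zpmf (x s) n k)).
    { intros s; symmetry; apply flux_S. }
    eapply derivable_pt_lim_eq;
      [|apply (derivable_pt_lim_plus (fun s => (1 - x s n) * flux c (x s) n k
          + x s n * flux c (x s) n (k - 1)) (fun s => c n * zpmf (x s) n k));
        [apply derivable_pt_lim_mix; auto
        |apply (derivable_pt_lim_scal (fun s => zpmf (x s) n k)),
          zpmf_derivative; auto]].
    cbv beta; ring.
Qed.

Lemma derivable_pt_lim_xlogx (x : R) :
  0 < x -> derivable_pt_lim xlogx x (ln x + 1).
Proof.
  intros Hx.
  apply (derivable_pt_lim_locally_ext (fun y => y * ln y) _ x 0 (x + 1)); [lra| |].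
  - intros y Hy; unfold xlogx; destruct (Rle_dec y 0); lra.
  - apply (derivable_pt_lim_eq _ _ (1 * ln x + x * / x)); [field; lra|].
    apply (derivable_pt_lim_mult (fun y => y) ln).
    + apply derivable_pt_lim_id.
    + apply derivable_pt_lim_ln; assumption.
Qed.

(** * Concavity for parameters inside (0,1) *)

(** The mean value theorem on both sides of the intermediate point gives the chord slopes as values
    of [H']; a third use, on [H'], orders them. *)
Lemma concave_of_second_derivative (H H' H'' : R -> R) :
  (forall t, 0 <= t <= 1 -> derivable_pt_lim H t (H' t)) ->
  (forall t, 0 <= t <= 1 -> derivable_pt_lim H' t (H'' t)) ->
  (forall t, 0 <= t <= 1 -> H'' t <= 0) -> concave_on_01 H.
Proof.
  intros D1 D2 N.
  assert (forall x y l, 0 <= x -> x < y -> y <= 1 -> 0 <= l <= 1 ->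
    l * H x + (1 - l) * H y <= H (l * x + (1 - l) * y)) as C.
  { intros x y l Hx Hxy Hy Hl.
    destruct (Req_dec l 0) as [->|L0].
    { replace (0 * x + (1 - 0) * y) with y by ring; lra. }
    destruct (Req_dec l 1) as [->|L1].
    { replace (1 * x + (1 - 1) * y) with x by ring; lra. }
    set (z := l * x + (1 - l) * y).
    assert (z - x = (1 - l) * (y - x)) as E1 by (unfold z; ring).
    assert (y - z = l * (y - x)) as E2 by (unfold z; ring).
    assert (x < z) by nra.
    assert (z < y) by nra.
    destruct (MVT_cor2 H H' x z) as [c1 [M1 B1]]; [lra|intros; apply D1; lra|].
    destruct (MVT_cor2 H H' z y) as [c2 [M2 B2]]; [lra|intros; apply D1; lra|].
    destruct (MVT_cor2 H' H'' c1 c2) as [c3 [M3 B3]];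
      [lra|intros; apply D2; lra|].
    assert (H'' c3 <= 0) by (apply N; lra).
    assert (H' c2 <= H' c1) as M by nra.
    rewrite E1 in M1; rewrite E2 in M2.
    assert (0 <= l * (1 - l) * (y - x) * (H' c1 - H' c2)).
    { repeat apply Rmult_le_pos; lra. }
    assert (l * (H z - H x) = l * (1 - l) * (y - x) * H' c1)
      by (rewrite M1; ring).
    assert ((1 - l) * (H y - H z) = l * (1 - l) * (y - x) * H' c2)
      by (rewrite M2; ring).
    lra. }
  intros x y l Hx Hy Hl.
  destruct (Rtotal_order x y) as [L|[->|L]].
  - apply C; lra.
  - replace (l * y + (1 - l) * y) with y by ring; lra.
  - replace (l * x + (1 - l) * y) with ((1 - l) * y + (1 - (1 - l)) * x) by ring.
    assert (X := C y x (1 - l)); lra.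
Qed.

Lemma entropy_zpmf (p : nat -> R) (n : nat) :
  entropy (pmf p n) n = - rsum (S n) (fun k => xlogx (zpmf p n (Z.of_nat k))).
Proof.
  unfold entropy; rewrite sum_f_R0_rsum; f_equal.
  apply rsum_ext; intros k _; rewrite zpmf_pmf; reflexivity.
Qed.

Lemma derivable_pt_lim_affine (a b t : R) :
  derivable_pt_lim (affine a b) t (b - a).
Proof.
  eapply derivable_pt_lim_eq; [|apply derivable_pt_lim_mix].
  2:{ apply derivable_pt_lim_id. }
  2:{ apply derivable_pt_lim_const. }
  2:{ apply derivable_pt_lim_const. }
  cbv beta; ring.
Qed.

(** The parameters stay in (0,1) up to the endpoints of [0,1], so all masses are positive there and
    the entropy can be differentiated twice. *)
Lemma entropy_concave_interior (n : nat) (a b : nat -> R) :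
  (forall i, (i < n)%nat -> 0 < a i < 1 /\ 0 < b i < 1) ->
  (forall i, (i < n)%nat -> a i <= b i) ->
  concave_on_01
    (fun t => entropy (pmf (fun i => affine (a i) (b i) t) n) n).
Proof.
  intros Hab Hle.
  pose (c i := b i - a i).
  pose (p t i := affine (a i) (b i) t).
  assert (forall t i, (i < n)%nat -> derivable_pt_lim (fun s => p s i) t (c i))
    as Dp by (intros; apply derivable_pt_lim_affine).
  assert (forall t i, 0 <= t <= 1 -> (i < n)%nat -> 0 < p t i < 1) as Hp.
  { intros t i Ht Hi; destruct (Hab i Hi); assert (L := Hle i Hi).
    unfold p, affine; nra. }
  assert (forall t k, 0 <= t <= 1 -> (k < S n)%nat ->
    0 < zpmf (p t) n (Z.of_nat k)) as F.
  { intros t k Ht Hk; apply zpmf_pos; [auto|lia]. }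
  apply (concave_of_second_derivative _
    (fun t => - rsum (S n) (fun k =>
      (ln (zpmf (p t) n (Z.of_nat k)) + 1)
      * (flux c (p t) n (Z.of_nat k - 1) - flux c (p t) n (Z.of_nat k))))
    (fun t => - rsum (S n) (fun k =>
      (flux2 c (p t) n (Z.of_nat k - 1 - 1) - flux2 c (p t) n (Z.of_nat k - 1)
       - (flux2 c (p t) n (Z.of_nat k - 1) - flux2 c (p t) n (Z.of_nat k)))
        * (ln (zpmf (p t) n (Z.of_nat k)) + 1)
      + (flux c (p t) n (Z.of_nat k - 1) - flux c (p t) n (Z.of_nat k))
        * (flux c (p t) n (Z.of_nat k - 1) - flux c (p t) n (Z.of_nat k))
        / zpmf (p t) n (Z.of_nat k)))).
  - intros t Ht.
    eapply derivable_pt_lim_ext; [intros s; symmetry; apply entropy_zpmf|].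
    apply (derivable_pt_lim_opp
      (fun s => rsum (S n) (fun k => xlogx (zpmf (p s) n (Z.of_nat k))))).
    apply (derivable_pt_lim_rsum (S n)
      (fun k s => xlogx (zpmf (p s) n (Z.of_nat k)))); intros k Hk.
    apply (derivable_pt_lim_comp (fun s => zpmf (p s) n (Z.of_nat k)) xlogx).
    + apply zpmf_derivative; auto.
    + apply derivable_pt_lim_xlogx; auto.
  - intros t Ht.
    apply (derivable_pt_lim_opp (fun s => rsum (S n) (fun k =>
      (ln (zpmf (p s) n (Z.of_nat k)) + 1)
      * (flux c (p s) n (Z.of_nat k - 1) - flux c (p s) n (Z.of_nat k))))).
    apply (derivable_pt_lim_rsum (S n) (fun k s =>
      (ln (zpmf (p s) n (Z.of_nat k)) + 1)
      * (flux c (p s) n (Z.of_nat k - 1) - flux c (p s) n (Z.of_nat k))));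
      intros k Hk.
    eapply derivable_pt_lim_eq;
      [|apply (derivable_pt_lim_mult
          (fun s => ln (zpmf (p s) n (Z.of_nat k)) + 1)
          (fun s => flux c (p s) n (Z.of_nat k - 1)
                    - flux c (p s) n (Z.of_nat k)));
        [apply (derivable_pt_lim_plus
           (fun s => ln (zpmf (p s) n (Z.of_nat k))) (fun _ => 1));
         [apply (derivable_pt_lim_comp (fun s => zpmf (p s) n (Z.of_nat k)) ln);
          [apply zpmf_derivative; auto|apply derivable_pt_lim_ln; auto]
         |apply derivable_pt_lim_const]
        |apply (derivable_pt_lim_minus (fun s => flux c (p s) n (Z.of_nat k - 1))
           (fun s => flux c (p s) n (Z.of_nat k)));
         apply flux_derivative; auto]].
    cbv beta; unfold Rdiv; ring.
  - intros t Ht.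
    assert (X := entropy_dissipation c (p t) n).
    apply Ropp_le_cancel; rewrite Ropp_0, Ropp_involutive; apply X; auto.
    intros i Hi; assert (a i <= b i) by auto; unfold c; lra.
Qed.

(** * Continuity of the entropy and passage to the limit *)

Lemma continuity_pt_xlogx (x : R) : continuity_pt xlogx x.
Proof.
  destruct (Rtotal_order x 0) as [Hx|[->|Hx]].
  - apply (continuity_pt_locally_ext (fun _ => 0) _ (- x)); [lra| |].
    + intros y Hy; unfold Rdist in Hy; apply Rabs_def2 in Hy.
      unfold xlogx; destruct (Rle_dec y 0); [reflexivity|lra].
    + apply continuity_pt_const; intros ? ?; reflexivity.
  - intros e He.
    (* With w = sqrt y, the bound -ln w <= 1/w - 1 gives -y ln y = 2 w (-w ln w) <= 2 w (1 - w) < 2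
       w < e; the radius 1 makes ln w negative. *)
    exists (Rmin 1 (Rsqr (e / 2))); split.
    { apply Rmin_glb_lt; [lra|apply Rsqr_pos_lt; lra]. }
    intros y [_ Hy]; simpl in *; unfold Rdist in *.
    rewrite Rminus_0_r in Hy.
    unfold xlogx at 2; destruct (Rle_dec 0 0) as [_|]; [|lra].
    rewrite Rminus_0_r.
    assert (Rabs y < 1) as Y1 by (eapply Rlt_le_trans; [apply Hy|apply Rmin_l]).
    assert (Rabs y < Rsqr (e / 2)) as Y2
      by (eapply Rlt_le_trans; [apply Hy|apply Rmin_r]).
    unfold xlogx; destruct (Rle_dec y 0) as [Ny|Py].
    { rewrite Rabs_R0; lra. }
    rewrite (Rabs_right y) in Y1, Y2 by lra.
    set (w := sqrt y).
    assert (0 < w) as W by (apply sqrt_lt_R0; lra).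
    assert (w * w = y) as Ew by (apply sqrt_def; lra).
    assert (w < e / 2) as We by (unfold Rsqr in Y2; nra).
    assert (ln w <= w - 1) by (apply ln_le_sub_1; assumption).
    assert (w < 1) by nra.
    assert (- ln w <= / w - 1).
    { rewrite <- ln_Rinv by assumption.
      apply ln_le_sub_1, Rinv_0_lt_compat; assumption. }
    assert (w * / w = 1) by (apply Rinv_r; lra).
    rewrite <- Ew, ln_mult by assumption.
    rewrite Rabs_left1 by nra.
    assert (w * - ln w <= w * (/ w - 1)) by (apply Rmult_le_compat_l; lra).
    nra.
  - apply derivable_continuous_pt; exists (ln x + 1).
    apply derivable_pt_lim_xlogx; assumption.
Qed.

Lemma continuity_pt_affine (u v : R -> R) (s t : R) :
  continuity_pt u t -> continuity_pt v t ->
  continuity_pt (fun r => affine (u r) (v r) s) t.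
Proof.
  intros U V; apply (continuity_pt_plus (fun r => (1 - s) * u r) (fun r => s * v r)).
  - apply (continuity_pt_scal u); assumption.
  - apply (continuity_pt_scal v); assumption.
Qed.

Lemma continuity_pt_zpmf (x : R -> nat -> R) (t : R) (n : nat) (k : Z) :
  (forall i, (i < n)%nat -> continuity_pt (fun s => x s i) t) ->
  continuity_pt (fun s => zpmf (x s) n k) t.
Proof.
  revert k; induction n as [|n IH]; intros k C; simpl.
  - apply continuity_pt_const; intros ? ?; reflexivity.
  - apply (continuity_pt_plus (fun s => (1 - x s n) * zpmf (x s) n k)
      (fun s => x s n * zpmf (x s) n (k - 1))).
    + apply (continuity_pt_mult (fun s => 1 - x s n) (fun s => zpmf (x s) n k));
        [|auto].
      apply (continuity_pt_minus (fun _ => 1) (fun s => x s n)); [|auto].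
      apply continuity_pt_const; intros ? ?; reflexivity.
    + apply (continuity_pt_mult (fun s => x s n) (fun s => zpmf (x s) n (k - 1)));
        auto.
Qed.

Lemma continuity_pt_rsum (n : nat) (u : nat -> R -> R) (t : R) :
  (forall i, (i < n)%nat -> continuity_pt (u i) t) ->
  continuity_pt (fun s => rsum n (fun i => u i s)) t.
Proof.
  induction n as [|n IH]; intros C; simpl.
  - apply continuity_pt_const; intros ? ?; reflexivity.
  - apply (continuity_pt_plus (fun s => rsum n (fun i => u i s)) (u n)); auto.
Qed.

Lemma continuity_pt_entropy (x : R -> nat -> R) (t : R) (n : nat) :
  (forall i, (i < n)%nat -> continuity_pt (fun s => x s i) t) ->
  continuity_pt (fun s => entropy (pmf (x s) n) n) t.
Proof.
  intros C.
  apply (continuity_pt_locally_ext (fun s => - rsum (S n) (fun k =>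
    xlogx (zpmf (x s) n (Z.of_nat k)))) _ 1); [lra| |].
  { intros s _; symmetry; apply entropy_zpmf. }
  apply (continuity_pt_opp (fun s => rsum (S n) (fun k =>
    xlogx (zpmf (x s) n (Z.of_nat k))))).
  apply (continuity_pt_rsum (S n)
    (fun k s => xlogx (zpmf (x s) n (Z.of_nat k)))); intros k _.
  apply (continuity_pt_comp (fun s => zpmf (x s) n (Z.of_nat k)) xlogx).
  - apply continuity_pt_zpmf; assumption.
  - apply continuity_pt_xlogx.
Qed.

Lemma nonneg_at_0 (u : R -> R) (d : R) :
  0 < d -> continuity_pt u 0 -> (forall e, 0 < e < d -> 0 <= u e) -> 0 <= u 0.
Proof.
  intros Hd C P.
  destruct (Rle_lt_dec 0 (u 0)) as [|N]; [assumption|exfalso].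
  destruct (C (- u 0)) as [r [Hr B]]; [lra|].
  simpl in B; unfold Rdist in B.
  set (e := Rmin r d / 2).
  assert (0 < Rmin r d) by (apply Rmin_glb_lt; lra).
  assert (Rmin r d <= r) by apply Rmin_l.
  assert (Rmin r d <= d) by apply Rmin_r.
  assert (0 <= u e) by (apply P; unfold e; lra).
  assert (Rabs (u e - u 0) < - u 0) as A.
  { apply B; split.
    - split; [exact I|unfold e; lra].
    - rewrite Rminus_0_r, Rabs_right; unfold e; lra. }
  apply Rabs_def2 in A; lra.
Qed.

(* p_i(t) = affine (a i) (b i) t, i = 0..n-1; p_i maps [0,1] into [0,1]
   iff a i, b i in [0,1]; p_i' = b i - a i >= 0. *)
Theorem theorem1p3 (n : nat) (a b : nat -> R) :
  (1 <= n)%nat ->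
  (forall i, (i < n)%nat -> 0 <= a i <= 1 /\ 0 <= b i <= 1) ->
  (forall i, (i < n)%nat -> a i <= b i) ->
  concave_on_01
    (fun t => entropy (pmf (fun i => affine (a i) (b i) t) n) n).
Proof.
  intros _ Hab Hle x y l Hx Hy Hl.
  (* For 0 < e < 1/2, [m e] is increasing and maps [0,1] onto [e, 1 - e], inside (0,1). *)
  pose (m e r := (1 - 2 * e) * r + e).
  pose (G e t := entropy (pmf (fun i => affine (m e (a i)) (m e (b i)) t) n) n).
  assert (forall t, G 0 t = entropy (pmf (fun i => affine (a i) (b i) t) n) n)
    as G0.
  { intros t; unfold G; rewrite !entropy_zpmf; f_equal.
    apply rsum_ext; intros k _; f_equal; apply zpmf_ext; intros i _.
    unfold m, affine; ring. }
  assert (forall t, continuity_pt (fun e => G e t) 0) as GC.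
  { intros t; apply continuity_pt_entropy; intros i _.
    assert (forall r, continuity_pt (fun e => m e r) 0) as M.
    (* As a function of [e], [m e r] is affine with value [r] at 0 and [1 - r] at 1. *)
    { intros r; apply derivable_continuous_pt; exists (1 - r - r).
      apply (derivable_pt_lim_ext (affine r (1 - r))).
      - intros e; unfold m, affine; ring.
      - apply derivable_pt_lim_affine. }
    apply (continuity_pt_affine (fun e => m e (a i)) (fun e => m e (b i))); apply M. }
  cbv beta; rewrite <- !G0.
  apply Rge_le, Rminus_ge, Rle_ge.
  apply (nonneg_at_0 (fun e => G e (l * x + (1 - l) * y)
    - (l * G e x + (1 - l) * G e y)) (/ 2)); [lra| |].
  - apply (continuity_pt_minus (fun e => G e (l * x + (1 - l) * y))
      (fun e => l * G e x + (1 - l) * G e y)); [apply GC|].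
    apply (continuity_pt_plus (fun e => l * G e x) (fun e => (1 - l) * G e y)).
    + apply (continuity_pt_scal (fun e => G e x)), GC.
    + apply (continuity_pt_scal (fun e => G e y)), GC.
  - intros e He; apply Rge_le, Rge_minus, Rle_ge.
    apply (entropy_concave_interior n (fun i => m e (a i)) (fun i => m e (b i)));
      try assumption.
    + intros i Hi; destruct (Hab i Hi); unfold m; nra.
    + intros i Hi; assert (a i <= b i) by auto; unfold m; nra.
Qed.
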